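(* Let $P$ be an even-special or an odd-special Dyck path. Then the permutation $\pi(P)$ recording the order in which horizontal steps are added while transforming $P$ into a (little or big, respectively) Schröder path by repeated application of the evolution map avoids the pattern $231$.
   Context: **Paths.** All lattice paths start at $(0,0)$, end on the $x$-axis, never go below the $x$-axis, and consist of upsteps U $=(1,1)$, downsteps $(1,-1)$, and double horizontal steps HH $=(2,0)$ (each an indivisible ''horizontal step''). Each downstep is either ordinary (D) or carries the label ''special'' (d). A Dyck path has no horizontal steps. An even-special (respectively odd-special) Dyck path is a Dyck path in which an arbitrary subset of the downsteps leaving from even (respectively odd) height are labeled special. **Matching upstep.** The upstep matching a downstep $d$ is the rightmost upstep to the left of $d$ that ends at the height from which $d$ leaves. **The evolution map** (called $e$ when starting from even-special, $E$ when starting from odd-special Dyck paths). If a path has no special steps it is left unchanged. Otherwise take the leftmost special step $s$. (Flatten) If $s$ is immediately preceded by an upstep, replace that upstep and $s$ by one horizontal step HH. (Slide) If $s$ is immediately preceded by a downstep $d$ (necessarily ordinary), let $u$ be the upstep matching $d$ and $Q$ the (possibly empty) subpath strictly between $u$ and $d$; replace the portion $u\,Q\,d\,s$ by HH $Q$ D, with D an ordinary downstep. For paths obtained from even- or odd-special Dyck paths these are the only cases that occur. Each application to a path with a special step creates exactly one new horizontal step and removes one special step; already existing horizontal steps are kept (those in $Q$ move along with $Q$). **The permutation $\pi(P)$.** Let $P$ have $m$ special steps. Apply the map $m$ times, giving the label $i$ to the horizontal step created by the $i$th application. The final path has no special steps and $m$ horizontal steps; $\pi(P)$ is the permutation of $\{1,\dots,m\}$,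 in one-line notation, obtained by reading the labels of its horizontal steps from left to right. **Pattern avoidance.** A permutation $\pi_1\cdots\pi_m$ avoids $231$ if there are no indices $i<j<k$ with $\pi_k<\pi_i<\pi_j$. *)

(* Defs.v *)
From mathcomp Require Import all_boot all_order all_algebra.

Set Implicit Arguments.
Unset Strict Implicit.
Unset Printing Implicit Defensive.

Import Order.TTheory GRing.Theory Num.Theory.

(* [Special] is a downstep carrying the label "special"; [Down] is an ordinary
   downstep.  [Horiz i] is one indivisible step (2,0); [i] records which
   application of the evolution map created it. *)
Inductive step := Up | Down | Special | Horiz of nat.

Definition is_up (s : step) : bool := if s is Up then true else false.
Definition is_special (s : step) : bool := if s is Special then true else false.
Definition is_horiz (s : step) : bool := if s is Horiz _ then true else false.

Definition rise (s : step) : int :=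
  match s with
  | Up => 1%R
  | Down | Special => (-1)%R
  | Horiz _ => 0%R
  end.

Definition height (p : seq step) : int := (\sum_(s <- p) rise s)%R.

(* Step number k of p (counted from 0) leaves from this height. *)
Definition start_height (p : seq step) (k : nat) : int := height (take k p).

Definition dyck_path (p : seq step) : Prop :=
  [/\ ~~ has is_horiz p,
      forall k : nat, (0 <= height (take k p))%R
    & height p = 0%R].

Definition even_special_dyck (p : seq step) : Prop :=
  dyck_path p /\
  forall k : nat, k < size p -> is_special (nth Down p k) ->
    ~~ odd `|start_height p k|%N.

Definition odd_special_dyck (p : seq step) : Prop :=
  dyck_path p /\
  forall k : nat, k < size p -> is_special (nth Down p k) ->
    odd `|start_height p k|%N.

(* Position of the rightmost upstep before position j that ends at the height
   from which step j leaves. *)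
Definition matching_upstep (p : seq step) (j : nat) : option nat :=
  ohead (rev [seq k <- iota 0 j |
    is_up (nth Down p k) && (height (take k.+1 p) == start_height p j)]).

(* One application of the evolution map, the new horizontal step being labelled
   i; the leftmost special step is at position j.+1.  The branches returning p
   when p has a special step are never reached from an even- or odd-special
   Dyck path. *)
Definition evolve (i : nat) (p : seq step) : seq step :=
  if has is_special p then
    if find is_special p is j.+1 then
      match nth Down p j with
      | Up => take j p ++ Horiz i :: drop j.+2 p
      | Down =>
          if matching_upstep p j is Some k then
            take k p ++ Horiz i :: drop k.+1 (take j p) ++ Down :: drop j.+2 p
          else p
      | _ => p
      end
    else p
  else p.

Definition evolution (p : seq step) : seq step :=
  foldl (fun q i => evolve i q) p (iota 1 (count is_special p)).

Definition horiz_label (s : step) : option nat :=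
  if s is Horiz i then Some i else None.

(* pi(p), in one-line notation. *)
Definition evolution_perm (p : seq step) : seq nat :=
  pmap horiz_label (evolution p).

Definition avoids231 (w : seq nat) : Prop :=
  ~ exists i j k : nat,
      [/\ i < j, j < k, k < size w,
          nth 0 w k < nth 0 w i & nth 0 w i < nth 0 w j].

(* Main.v *)
(** The special steps are treated from left to right, so the path is always
    [W ++ R] where [W] has no special step and [R] no horizontal step.  An
    application of the map turns a suffix [Up :: B] of [W] into [Horiz i :: B],
    with [B] empty (flatten) or [B = Q D] (slide), where [i] exceeds all
    labels of [W].  Inserting a maximum keeps [231] out as soon as every label
    on its left is smaller than every label on its right.  This holds because
    the labels following an upstep that is unmatched, or matched by the very
    last step of [W], were created after those preceding it.  Parity of the
    heights plays no role: it only ensures that the map never gets stuck. *)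
Require Import Defs.
From mathcomp Require Import all_boot all_order all_algebra.
From mathcomp Require Import zify.

Set Implicit Arguments.
Unset Strict Implicit.
Unset Printing Implicit Defensive.

Lemma cat_cons_split (T : Type) (s1 t1 s2 t2 : seq T) (x y : T) :
  s1 ++ x :: s2 = t1 ++ y :: t2 ->
  [\/ [/\ s1 = t1, x = y & s2 = t2],
      exists2 c, t1 = s1 ++ x :: c & s2 = c ++ y :: t2
    | exists2 c, s1 = t1 ++ y :: c & t2 = c ++ x :: s2].
Proof.
elim: s1 t1 => [|a s1 IH] [|b t1] /=.
- by case=> -> ->; constructor 1.
- by case=> -> ->; constructor 2; exists t1.
- by case=> -> <-; constructor 3; exists s1.
case=> -> /IH[[-> -> ->]|[c -> ->]|[c -> ->]].
- by constructor 1.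
- by constructor 2; exists c.
- by constructor 3; exists c.
Qed.

(** An occurrence of 231 that uses the new [i] must use it as the 3, which puts the 2 in [s] and the
    1 in [t], against [allrel ltn s t]. Any other occurrence survives the deletion of [i]. *)
Lemma avoids231_insert_max (i : nat) (s t : seq nat) :
  avoids231 (s ++ t) -> all (ltn^~ i) (s ++ t) -> allrel ltn s t ->
  avoids231 (s ++ i :: t).
Proof.
move=> av /all_nthP lti /allrelP lt_st [a [b [c [ab bc]]]].
rewrite size_cat /= addnS => c_lt.
(* Deleting the entry at [size s] lowers the later positions by one. *)
have nthE x : nth 0 (s ++ i :: t) x =
    if x == size s then i else nth 0 (s ++ t) (if x < size s then x else x.-1).
  rewrite !nth_cat; case: (ltngtP x (size s)) => [-> //| xs |->].
  - by rewrite ifF; [case: x xs => [|x] xs; rewrite ?subSn //= | lia].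
  - by rewrite subnn.
have lt_i x : x <= size s + size t -> x != size s ->
    nth 0 (s ++ t) (if x < size s then x else x.-1) < i.
  by move=> xs xN; apply: lti; rewrite size_cat; case: ifP; lia.
rewrite !nthE; have := lt_i a; have := lt_i b.
case: (eqVneq a (size s)) => [aE|aN].
  have -> : b == size s = false by lia.
  by lia.
case: (eqVneq c (size s)) => [cE|cN]; first lia.
case: (eqVneq b (size s)) => [bE|bN] _ _.
  have a_s : a < size s by lia.
  have c_t : c.-1 - size s < size t by lia.
  have := lt_st _ _ (mem_nth 0 a_s) (mem_nth 0 c_t).
  have -> : c < size s = false by lia.
  rewrite a_s !nth_cat a_s (_ : c.-1 < size s = false) /=; lia.
move=> ca ab'; apply: av.
exists (if a < size s then a else a.-1), (if b < size s then b else b.-1),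
  (if c < size s then c else c.-1).
by split=> //; rewrite ?size_cat; do ?case: ifP; lia.
Qed.

Notation labels := (pmap horiz_label).

Lemma labels_cat (p q : seq step) : labels (p ++ q) = labels p ++ labels q.
Proof. exact: pmap_cat. Qed.

Lemma labels_nil (p : seq step) : ~~ has is_horiz p -> labels p = [::].
Proof. by elim: p => //= -[|||n]. Qed.

Lemma height_cat (p q : seq step) : height (p ++ q) = (height p + height q)%R.
Proof. exact: big_cat. Qed.

Lemma height_cons (s : step) (p : seq step) :
  height (s :: p) = (rise s + height p)%R.
Proof. exact: big_cons. Qed.

Lemma height_nil : height [::] = 0%R.
Proof. exact: big_nil. Qed.

(* An upstep followed by [B] is unmatched in [B], or matched by its last step. *)
Definition pending (B : seq step) : Prop :=
  forall B1 x B2, B = B1 ++ x :: B2 -> (0 <= height B1)%R.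

Definition pending_increasing (W : seq step) : Prop :=
  forall A B, W = A ++ Up :: B -> pending B -> allrel ltn (labels A) (labels B).

Definition good (i : nat) (W : seq step) : Prop :=
  [/\ pending_increasing W, all (ltn^~ i) (labels W) & avoids231 (labels W)].

(** [pending] constrains proper prefixes only, so it survives the removal of the last step [x],
    which carries no label. *)
Lemma good_rcons (i : nat) (W : seq step) (x : step) :
  ~~ is_horiz x -> good i W -> good i (rcons W x).
Proof.
move=> xN [inc lti av].
have lE V : labels (rcons V x) = labels V.
  by rewrite -cats1 labels_cat (@labels_nil [:: x]) ?cats0 //= orbF.
split; rewrite ?lE // => A B.
case/lastP: B => [|B y]; first by rewrite allrel0r.
rewrite -rcons_cons -rcons_cat => /rcons_inj[WE <-] pB; rewrite lE.
apply: inc WE _ => B1 z B2 BE; apply: (pB B1 z (rcons B2 x)).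
by rewrite BE rcons_cat.
Qed.

Lemma good_cat (i : nat) (W T : seq step) :
  ~~ has is_horiz T -> good i W -> good i (W ++ T).
Proof.
elim: T W => [|x T IH] W /=; first by rewrite cats0.
by rewrite negb_or => /andP[xN TN] gW; rewrite -cat_rcons; apply/IH/good_rcons.
Qed.

(** A pending upstep of the new path cannot lie in [B], by the second hypothesis. If it lies in [V],
    it was pending before the replacement too, so the old ordering applies, and [i] exceeds every
    label to its left. *)
Lemma good_insert (i : nat) (V B : seq step) :
  pending B -> (forall B1 B2, B = B1 ++ Up :: B2 -> ~ pending B2) ->
  good i (V ++ Up :: B) -> good i.+1 (V ++ Horiz i :: B).
Proof.
move=> pB inB [inc]; rewrite labels_cat /= => lti av.
have lt_VB : allrel ltn (labels V) (labels B) by apply: inc pB.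
split; last 2 first.
- rewrite labels_cat /=; move: lti; rewrite !all_cat /= ltnSn => /andP[ltV ltB].
  by rewrite !(sub_all _ ltV, sub_all _ ltB) // => x /=; lia.
- by rewrite labels_cat /=; apply: avoids231_insert_max.
move=> A B' /esym E; case: (cat_cons_split E) => {E} [[_ //]|[C VE BE] pB'|[C _ BE /(inB _ _ BE)//]].
have: allrel ltn (labels A) (labels (C ++ Up :: B)).
  apply: inc; first by rewrite VE -catA.
  (* The prefix [D] ends just before the restored [Up], earlier, or after it; in the last case it is
     one higher than with [Horiz i]. *)
  move=> D x D' /esym E; case: (cat_cons_split E) => {E} [[CD _ _]|[c CE _]|[c -> BcE]].
  - by apply: (pB' D (Horiz i) B); rewrite BE CD.
  - by apply: (pB' _ x (c ++ Horiz i :: B)); rewrite BE CE -catA.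
  - have := pB' (C ++ Horiz i :: c) x D'; rewrite BE BcE -catA => /(_ erefl).
    by rewrite !height_cat !height_cons /=; lia.
rewrite BE !labels_cat /= !allrel_catr.
move=> /andP[-> AB]; rewrite allrel_consr AB andbT /=.
by move: lti; rewrite VE labels_cat !all_cat => /andP[/andP[]].
Qed.

Lemma good_flatten (i : nat) (V : seq step) :
  good i (rcons V Up) -> good i.+1 (rcons V (Horiz i)).
Proof. by rewrite -!cats1; apply: good_insert => [[]|[]]. Qed.

(** The proper prefixes of [rcons Q Down] are prefixes of [Q], so it is pending. After any upstep of
    [Q], the rest of [Q] has negative height: that upstep is matched before the final [Down]. *)
Lemma good_slide (i : nat) (V Q : seq step) :
  (forall Q1 Q2, Q = Q1 ++ Q2 -> (0 <= height Q1)%R) -> height Q = 0%R ->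
  good i (V ++ Up :: rcons Q Down) -> good i.+1 (V ++ Horiz i :: rcons Q Down).
Proof.
move=> Q_ge0 Q0; apply: good_insert => [B1 x B2|B1 B2].
  case/lastP: B2 => [|B2 y].
    by rewrite cats1 => /rcons_inj[<- _]; rewrite Q0.
  by rewrite -rcons_cons -rcons_cat => /rcons_inj[/Q_ge0].
case/lastP: B2 => [|B2 y]; first by rewrite cats1 => /rcons_inj[].
rewrite -rcons_cons -rcons_cat => /rcons_inj[QE <-] /(_ B2 Down [::]).
rewrite cats1 => /(_ erefl); have := Q_ge0 _ _ QE.
by move: Q0; rewrite QE height_cat height_cons /=; lia.
Qed.

(** Extend [Q1] until the next step leaves the negative heights: this is an upstep from -1 to 0, and
    what follows it has height 0. *)
Lemma neg_prefix_up (Q1 Q2 : seq step) :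
  (height Q1 < 0)%R -> height (Q1 ++ Q2) = 0%R ->
  exists R1 R2, Q1 ++ Q2 = R1 ++ Up :: R2 /\ height R2 = 0%R.
Proof.
elim: Q2 Q1 => [|x Q2 IH] Q1 Q1_lt0; first by rewrite cats0; lia.
move=> Q0; have [Qx_lt0|Qx_ge0] := boolP (height (rcons Q1 x) < 0)%R.
  by have := IH (rcons Q1 x); rewrite cat_rcons; apply.
exists Q1, Q2; move: Qx_ge0 Q0; rewrite -cats1 !height_cat !height_cons height_nil.
by case: x => [|||n] /=; split=> //; lia.
Qed.

Lemma ohead_rev_filter_iota (a : pred nat) (j k : nat) :
  ohead (rev [seq x <- iota 0 j | a x]) = Some k ->
  [/\ k < j, a k & forall l, k < l < j -> ~~ a l].
Proof.
elim: j => // j IH; rewrite -addn1 iotaD filter_cat rev_cat /= add0n.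
case: ifP => [aj [<-]|aj /IH[kj ak last_k]].
  by split=> //; [lia | move=> l; lia].
split=> //; first lia; move=> l /andP[kl lj].
by have [->|lNj] := eqVneq l j; [rewrite aj | apply: last_k; lia].
Qed.

(** If [Q] dipped below its starting height, its return would contain an upstep to the right of
    position [k] ending at the same height, so [k] would not be the rightmost candidate. *)
Lemma matching_upstepP (V R : seq step) (k : nat) :
  matching_upstep (V ++ R) (size V) = Some k ->
  exists V1 Q, [/\ V = V1 ++ Up :: Q, size V1 = k, height Q = 0%R &
    forall Q1 Q2, Q = Q1 ++ Q2 -> (0 <= height Q1)%R].
Proof.
move=> /ohead_rev_filter_iota[kV /andP[k_up /eqP k_h] k_last].
have VE : V = take k V ++ Up :: drop k.+1 V.
  rewrite -{1}(cat_take_drop k V) (drop_nth Down kV); congr (_ ++ _ :: _).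
  by move: k_up; rewrite nth_cat kV; case: nth.
have sz : size (take k V) = k by rewrite size_takel // ltnW.
have take_V m : m <= size V -> take m (V ++ R) = take m V.
  by move=> mV; rewrite takel_cat.
have Q0 : height (drop k.+1 V) = 0%R.
  move: k_h; rewrite /start_height !take_V // take_size.
  by rewrite -{2}(cat_take_drop k.+1 V) height_cat; lia.
exists (take k V), (drop k.+1 V); split=> // Q1 Q2 QE.
have [//|Q1_lt0] := boolP (0 <= height Q1)%R.
have {}Q1_lt0 : (height Q1 < 0)%R by lia.
rewrite QE in Q0; have [R1 [R2 [RE R20]]] := neg_prefix_up Q1_lt0 Q0.
set V2 := take k V ++ Up :: R1.
have V2E : V = V2 ++ Up :: R2 by rewrite /V2 -catA /= -RE -QE.
have V2_lt : size V2 < size V by rewrite V2E size_cat /=; lia.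
have /k_last : k < size V2 < size V.
  by rewrite V2_lt andbT /V2 size_cat sz /=; lia.
case/negP; apply/andP; split.
  by rewrite nth_cat V2_lt V2E nth_cat ltnn subnn.
rewrite /start_height !take_V // take_size V2E -cat_rcons.
rewrite take_size_cat ?size_rcons // -cats1 !height_cat R20; lia.
Qed.

Definition evolution_inv (i : nat) (p : seq step) : Prop :=
  exists W R, [/\ p = W ++ R, ~~ has is_special W, ~~ has is_horiz R & good i W].

Lemma first_special_split (R : seq step) :
  has is_special R ->
  exists T R', R = T ++ Special :: R' /\ ~~ has is_special T.
Proof.
elim: R => //= x R IH; have [|xN /= /IH[T [R' [-> TN]]]] := boolP (is_special x).
  by case: x => // _ _; exists [::], R.
by exists (x :: T), R'; rewrite /= negb_or xN.
Qed.

Lemma goodS (i : nat) (W : seq step) : good i W -> good i.+1 W.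
Proof. by case=> inc lti av; split=> //; apply: sub_all lti => x /=; lia. Qed.

Lemma evolve_inv (i : nat) (p : seq step) :
  evolution_inv i p -> evolution_inv i.+1 (evolve i p).
Proof.
move=> [W0 [R0 [pE W0N R0N gW0]]].
(* This settles every branch where [evolve] returns [p]: only the bound on the labels is relaxed. *)
have stuck : evolution_inv i.+1 p by exists W0, R0; split=> //; apply: goodS.
rewrite /evolve; case: ifP => // spp.
have /first_special_split[T [R [R0E TN]]] : has is_special R0.
  by move: spp; rewrite pE has_cat (negPf W0N).
have [/norP[TNh RN] WN] : ~~ (has is_horiz T || has is_horiz R)
    /\ ~~ has is_special (W0 ++ T).
  by move: R0N; rewrite R0E !has_cat /= (negPf W0N) (negPf TN).
(* The steps [T] before the leftmost special step carry no label and join the processed part. *)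
have {gW0} := good_cat TNh gW0.
have {}pE : p = (W0 ++ T) ++ Special :: R by rewrite pE R0E catA.
move: (W0 ++ T) pE WN => W pE WN gW.
have -> : find is_special p = size W.
  by rewrite pE find_cat (negPf WN) /= addn0.
(* If [W] is empty, the path begins with its special step and [evolve] leaves it unchanged. *)
case/lastP: W pE WN gW => [//|V x] pE; rewrite size_rcons has_rcons negb_or.
have {}pE : p = V ++ x :: Special :: R by rewrite pE cat_rcons.
have takeV : take (size V) p = V by rewrite pE take_size_cat.
have dropV : drop (size V).+2 p = R.
  by rewrite pE drop_cat ltnNge -addn2 leq_addr /= addKn /= drop0.
have -> : nth Down p (size V) = x by rewrite pE nth_cat ltnn subnn.
case: x pE => [|||n] // pE /andP[_ VN] gW.
  rewrite takeV dropV; exists (rcons V (Horiz i)), R.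
  by rewrite cat_rcons has_rcons /=; split=> //; apply: good_flatten.
case mE: matching_upstep => [k|] //; move: mE; rewrite {1}pE.
move=> /matching_upstepP[V1 [Q [VE kE Q0 Q_ge0]]].
rewrite takeV dropV; have -> : take k p = V1.
  by rewrite pE VE -catA take_size_cat.
have -> : drop k.+1 V = Q.
  by rewrite VE -cat_rcons drop_size_cat // size_rcons kE.
exists (V1 ++ Horiz i :: rcons Q Down), R.
rewrite -catA /= cat_rcons; split=> //.
  by move: VN; rewrite VE !has_cat /= has_rcons.
by apply: good_slide => //; rewrite -rcons_cons -rcons_cat -VE.
Qed.

Lemma evolution_invP (m i : nat) (p : seq step) :
  evolution_inv i p ->
  exists j, evolution_inv j (foldl (fun q l => evolve l q) p (iota i m)).
Proof.
by elim: m i p => [|m IH] i p inv_p /=; [exists i | apply/IH/evolve_inv].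
Qed.

Theorem theorem10 (P : seq step)
    (hP : even_special_dyck P \/ odd_special_dyck P) :
  avoids231 (evolution_perm P).
Proof.
have PN : ~~ has is_horiz P by case: hP => [] [[]].
have inv_P : evolution_inv 1 P.
  (* Initially nothing is processed. *)
  exists [::], P; split=> //; split=> [[]||[i [j [k []]]]] //.
have [j [W [R [pE _ RN [_ _ av]]]]] :=
  evolution_invP (count is_special P) inv_P.
(* All labels lie in [W], since [R] has no horizontal step. *)
by rewrite /evolution_perm /evolution pE labels_cat (labels_nil RN) cats0.
Qed.
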